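(* Let $G_K$ be a grid diagram, with grid number $n$, of an oriented knot $K\subset L(p,q)$, and let $-G_K$ be the grid diagram of $-K$ obtained by exchanging the elements of $\mathbb O$ and $\mathbb X$ in $G_K$. There is a fixed integer $k$ and a one to one correspondence between the generators of $H(C(G_K),\partial)$ and those of $H(C(-G_K),\partial)$ (homogeneous bases over $\mathbb Z_2$) under which a generator of $H(C(G_K),\partial)$ having spin degree $s$, Maslov degree $m$ and Alexander degree $a$ corresponds to a generator of $H(C(-G_K),\partial)$ with spin degree $s+k$ (in $\mathbb Z_p$), Maslov degree $m-2a-(n-1)$ and Alexander degree $-a-(n-1)$.
   Context: $p>q\ge0$ are coprime integers; $-K$ is $K$ with reversed orientation. Grid diagram. $G=(T^2,\boldsymbol\alpha,\boldsymbol\beta,\mathbb O,\mathbb X)$ with grid number $n$: $T^2=\mathbb R^2/\mathbb Z^2$ with the standard orientation; $\boldsymbol\alpha=\{\alpha_0,\dots,\alpha_{n-1}\}$ are the images of the lines $y=i/n$; $\boldsymbol\beta=\{\beta_0,\dots,\beta_{n-1}\}$ are the images of the lines $y=-\frac pq(x-\frac i{pn})$ (vertical if $q=0$); $\mathbb O$ and $\mathbb X$ are sets of $n$ points in the complement of these curves, two points of the same set lying in different rows (components of $T^2\smallsetminus\bigcup\alpha_i$) and different columns (components of $T^2\smallsetminus\bigcup\beta_i$). The link represented by $G$ in $L(p,q)=V_{\boldsymbol\alpha}\cup_{T^2}V_{\boldsymbol\beta}$ (solid tori with meridians $\boldsymbol\alpha$, $\boldsymbol\beta$) is obtained by joining $X$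 to $O$ in each row by an arc (oriented from $X$ to $O$) pushed into $V_{\boldsymbol\alpha}$, and $O$ to $X$ in each column by an arc pushed into $V_{\boldsymbol\beta}$. Coordinates. In the coordinates $(a,b)=(npx+nqy,\,ny)$ of the basis $\vec v_1=(\frac1{np},0)$, $\vec v_2=(-\frac q{np},\frac1n)$, each point of $T^2$ has coordinates with $a\in[0,pn)$, $b\in[0,n)$; the points of $\alpha_i\cap\beta_j$ are $(j+cn,\,i)$, $c=0,\dots,p-1$, and $(j+cn,i)$ is called the $c$-th intersection point. Markings are placed at the centers of their cells. Complex. $Y$ is the set of unordered $n$-tuples $\mathbf x$ of points of $\boldsymbol\alpha\cap\boldsymbol\beta$ such that each $\alpha_i$ and each $\beta_i$ contains exactly one point of $\mathbf x$. $Y$ is in bijection with $S_n\times\mathbb Z_p^n$: $(\sigma,(a_0,\dots,a_{n-1}))$ corresponds to the $\mathbf x$ whose point on $\alpha_i$ is the $a_i$-th intersection point of $\alpha_i\cap\beta_{\sigma(i)}$. $C(G)$ is the $\mathbb Z_2$-vector space with basis $Y$. A parallelogram is a quadrilateral properly embedded in $T^2$ with vertices in $\boldsymbol\alpha\cap\boldsymbol\beta$ and sides on curves of $\boldsymbol\alpha$ and $\boldsymbol\beta$. A parallelogram $P$ connects $\mathbf x$ to $\mathbf y$ if $\mathbf x,\mathbf y$ differ in at most two components $\{x_i,x_j\}$, $\{y_i,y_j\}$, these being the vertices of $P$, and, in the boundary orientation of $P$ induced from $T^2$, the sides of $P$ on $\boldsymbol\alpha$ go from vertices in $\mathbf x$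 to vertices in $\mathbf y$. It is admissible if its interior contains no point of $\mathbf x$ or $\mathbf y$. $PG(\mathbf x,\mathbf y)$ is the set of admissible parallelograms connecting $\mathbf x$ to $\mathbf y$; $n_{\mathbb O}(P)$, $n_{\mathbb X}(P)$ are the numbers of $O$ and $X$ markings in $P$. Then $$\partial\mathbf x=\sum_{\mathbf y\in Y}\#\{P\in PG(\mathbf x,\mathbf y): n_{\mathbb O}(P)=n_{\mathbb X}(P)=0\}\,\mathbf y .$$ Spin degree. Let $\mathbf x_{\mathbb O}\in Y$ be the generator whose points are the lower left vertices of the $n$ cells (components of $T^2\smallsetminus(\boldsymbol\alpha\cup\boldsymbol\beta)$) containing elements of $\mathbb O$. If $\mathbf x_{\mathbb O}$ corresponds to $(\sigma_{\mathbb O},(a_0,\dots,a_{n-1}))$ and $\mathbf x$ to $(\sigma,(b_0,\dots,b_{n-1}))$, then $\mathbf S(\mathbf x)=q-1+\sum b_i-\sum a_i\in\mathbb Z_p$. Maslov degree. Let $W$ assign to a finite set of points of $T^2$ the set of their coordinates $(a,b)$ above. $C_{p,q}$ replaces each $(a,b)$ by the $p$ points $(a+nqk'\bmod np,\ b+nk')$, $k'=0,\dots,p-1$, and $\widetilde W=C_{p,q}\circ W$. For finite sets $A,B$ of pairs, $I(A,B)$ is the number of $((a_1,a_2),(b_1,b_2))\in A\times B$ with $a_1<b_1$ and $a_2<b_2$. Define recursively $d(1,0,0)=0$ and $d(p,q,i)=\frac{pq-(2i+1-p-q)^2}{4pq}-d(q,r,j)$ with $r\equiv p$, $j\equiv i\pmod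 q$ reduced modulo $q$. For $\mathbb M\in\{\mathbb O,\mathbb X\}$ set $$\mathbf M_{\mathbb M}(\mathbf x)=\tfrac1p\bigl(I(\widetilde W(\mathbf x),\widetilde W(\mathbf x))-I(\widetilde W(\mathbf x),\widetilde W(\mathbb M))-I(\widetilde W(\mathbb M),\widetilde W(\mathbf x))+I(\widetilde W(\mathbb M),\widetilde W(\mathbb M))+1\bigr)+d(p,q,q-1)+\tfrac{p-1}p .$$ The Maslov degree is $\mathbf M(\mathbf x)=\mathbf M_{\mathbb O}(\mathbf x)\in\mathbb Q$. Alexander degree. $\mathbf A(\mathbf x)=\frac12\bigl(\mathbf M_{\mathbb O}(\mathbf x)-\mathbf M_{\mathbb X}(\mathbf x)-(n-1)\bigr)\in\mathbb Q$. For $-G_K$ all degrees are computed with the roles of $\mathbb O$ and $\mathbb X$ exchanged. One has $\partial^2=0$, and $\partial$ preserves $\mathbf S$ and $\mathbf A$ and lowers $\mathbf M$ by $1$, so $H(C(G),\partial)$ is a $\mathbb Z_2$-vector space graded by the three degrees. *)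

(* Defs.v *)
From HB Require Import structures.
From mathcomp Require Import all_boot all_order all_algebra.

Set Implicit Arguments.
Unset Strict Implicit.
Unset Printing Implicit Defensive.

Import Order.TTheory GRing.Theory Num.Theory.
Local Open Scope ring_scope.

(* The torus R^2/Z^2 is described in the coordinates
   (a, b) = (n p x + n q y, n y).  In these (orientation preserving) coordinates
   Z^2 becomes the lattice generated by (n p, 0) and (n q, n), alpha_i is the
   image of the line b = i, and beta_j is the image of the lines a = j + c n.
   A point of alpha \cap beta is given by its representative in
   [0, pn) x [0, n); it lies on alpha_i for i = b and on beta_j for
   j = a mod n, and it is the (a div n)-th point of this intersection.
   A cell [a, a+1] x [b, b+1] is denoted by its lower left vertex (a, b). *)

Definition point (p n : nat) : Type := ('I_(p * n) * 'I_n)%type.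

(* (u, v) belongs to the lattice generated by (n p, 0) and (n q, n). *)
Definition lattice (p q n : nat) (u v : int) : bool :=
  (n%:Z %| v)%Z && ((p * n)%:Z %| u - q%:Z * v)%Z.

(* n cells, two of them lying neither in the same row nor in the same column *)
Definition is_marking (p n : nat) (A : {set point p n}) : Prop :=
  [/\ #|A| = n,
      {in A &, injective (fun z : point p n => z.2)} &
      {in A &, injective (fun z : point p n => (z.1 %% n)%N)}].

(* The markings are placed at the centers of the cells of OO and XX. *)
Record grid (p n : nat) := Grid {
  OO : {set point p n};
  XX : {set point p n};
  OO_marking : is_marking OO;
  XX_marking : is_marking XX
}.

Definition swap_grid (p n : nat) (G : grid p n) : grid p n :=
  Grid (XX_marking G) (OO_marking G).

(* Following the link from the O in row i, along its column, to the X of that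
   column, which lies in row j; the link then goes on along row j to its O. *)
Definition link_step (p n : nat) (G : grid p n) : rel 'I_n :=
  fun i j => [exists o in OO G, exists x in XX G,
    [&& o.2 == i, (o.1 %% n == x.1 %% n)%N & x.2 == j]].

(* The link has exactly one component. *)
Definition represents_knot (p n : nat) (G : grid p n) : Prop :=
  (0 < n)%N /\ forall i j : 'I_n, connect (link_step G) i j.

Definition is_generator (p n : nat) (x : {set point p n}) : bool :=
  [forall i : 'I_n, #|[set z in x | z.2 == i]| == 1%N] &&
  [forall j : 'I_n, #|[set z in x | (z.1 %% n)%N == j]| == 1%N].

Definition generator (p n : nat) : Type :=
  {x : {set point p n} | is_generator x}.

(* The image of [a, a + w] x [b, b + h], given as ((a, b), w, h).  An embedded
   parallelogram has w, h < p n, because (p n, 0) and (0, p n) are in the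
   lattice; no other bound is imposed, so that a parallelogram may also be
   higher than n or wider than n. *)
Definition parallelogram (p n : nat) : Type :=
  (point p n * 'I_(p * n) * 'I_(p * n))%type.

Section Parallelograms.
Variables (p q n : nat).
Implicit Types (P : parallelogram p n) (x y : {set point p n}).

Definition corner P : point p n := P.1.1.
Definition width P : nat := P.1.2.
Definition height P : nat := P.2.

(* z is the point at position (u, v) from the lower left corner of P; for
   cells, z is the cell whose lower left vertex is at this position. *)
Definition at_pos P (u v : nat) (z : point p n) : bool :=
  lattice p q n (z.1%:Z - ((corner P).1%:Z + u%:Z))
                (z.2%:Z - ((corner P).2%:Z + v%:Z)).

(* The lattice consists of integer vectors, so the closed real rectangle
   injects into the torus as soon as its integer points do. *)
Definition embedded P : bool :=
  [&& (0 < width P)%N, (0 < height P)%N &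
   [forall u : 'I_(width P).+1, forall u' : 'I_(width P).+1,
    forall v : 'I_(height P).+1, forall v' : 'I_(height P).+1,
      lattice p q n (u%:Z - u'%:Z) (v%:Z - v'%:Z) ==>
        (u == u') && (v == v')]].

(* In the boundary orientation the lower side goes to the right and the upper
   side goes to the left: the lower left and upper right vertices are in x. *)
Definition connects P x y : bool :=
  [exists x1 in x, exists x2 in x, exists y1 in y, exists y2 in y,
    [&& at_pos P 0 0 x1, at_pos P (width P) (height P) x2,
        at_pos P (width P) 0 y1, at_pos P 0 (height P) y2 &
        x :\: [set x1; x2] == y :\: [set y1; y2]]].

Definition in_interior P (z : point p n) : bool :=
  [exists u : 'I_(width P), exists v : 'I_(height P),
    [&& (0 < u)%N, (0 < v)%N & at_pos P u v z]].

Definition admissible P x y : bool :=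
  [forall z in x :|: y, ~~ in_interior P z].

Definition PG x y : {set parallelogram p n} :=
  [set P | [&& embedded P, connects P x y & admissible P x y]].

Definition contains_cell P (z : point p n) : bool :=
  [exists u : 'I_(width P), exists v : 'I_(height P), at_pos P u v z].

Definition num_marked (A : {set point p n}) P : nat :=
  #|[set z in A | contains_cell P z]|.

End Parallelograms.

Definition chain (p n : nat) : Type := {ffun generator p n -> ('F_2)^o}.

Section Differential.
Variables (p q n : nat) (G : grid p n).

Definition differential_fun (c : chain p n) : chain p n :=
  [ffun y => \sum_(x : generator p n) c x *
     #|[set P in PG q (val x) (val y) |
          (num_marked q (OO G) P == 0%N) && (num_marked q (XX G) P == 0%N)]|%:R].

Lemma differential_linear : linear differential_fun.
Proof.
move=> k c d; apply/ffunP => y; rewrite !ffunE scaler_sumr -big_split /=.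
by apply: eq_bigr => x _; rewrite !ffunE mulrDl scalerAl.
Qed.

HB.instance Definition _ := GRing.isLinear.Build 'F_2 (chain p n) (chain p n) _
  differential_fun differential_linear.

Definition differential : 'End(chain p n) := linfun differential_fun.

End Differential.

Definition intersection_sum (p n : nat) (x : {set point p n}) : nat :=
  (\sum_(z in x) z.1 %/ n)%N.

(* Z_p is represented by the residues in [0, p).  The lower left vertices of
   the cells of OO form the set of points OO itself. *)
Definition spin (p q n : nat) (G : grid p n) (x : generator p n) : int :=
  ((q%:Z - 1 + (intersection_sum (val x))%:Z - (intersection_sum (OO G))%:Z)
     %% p%:Z)%Z.

Definition W_points (p n : nat) (x : {set point p n}) : seq (rat * rat) :=
  [seq ((nat_of_ord z.1)%:R, (nat_of_ord z.2)%:R) | z <- enum x].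

Definition W_markings (p n : nat) (M : {set point p n}) : seq (rat * rat) :=
  [seq ((nat_of_ord z.1)%:R + 2^-1, (nat_of_ord z.2)%:R + 2^-1)
     | z <- enum M].

Definition rat_mod (a m : rat) : rat := a - m * (Num.floor (a / m))%:~R.

Definition C_lift (p q n : nat) (A : seq (rat * rat)) : seq (rat * rat) :=
  [seq (rat_mod (z.1 + (n * q * k)%:R) (n * p)%:R, z.2 + (n * k)%:R)
     | z <- A, k <- iota 0 p].

Definition II (A B : seq (rat * rat)) : nat :=
  (\sum_(u <- A) \sum_(v <- B) ((u.1 < v.1)%R && (u.2 < v.2)%R))%N.

(* The second argument strictly decreases in the recursion, hence fuel q is
   enough.  The recursion stops at q = 0, where p = 1 by coprimality. *)
Fixpoint d_fuel (fuel p q i : nat) : rat :=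
  if fuel is fuel'.+1 then
    if q == 0%N then 0 else
      ((p * q)%:R - (2 * i%:R + 1 - p%:R - q%:R) ^+ 2) / (4 * p%:R * q%:R)
        - d_fuel fuel' q (p %% q) (i %% q)
  else 0.

Definition d_inv (p q i : nat) : rat := d_fuel q p q i.

Definition maslov_of (p q n : nat) (M : {set point p n}) (x : generator p n) :
    rat :=
  let wx := C_lift p q n (W_points (val x)) in
  let wm := C_lift p q n (W_markings M) in
  p%:R^-1 * ((II wx wx)%:R - (II wx wm)%:R - (II wm wx)%:R + (II wm wm)%:R + 1)
  + d_inv p q q.-1 + (p%:R - 1) / p%:R.

Definition maslov (p q n : nat) (G : grid p n) (x : generator p n) : rat :=
  maslov_of q (OO G) x.

Definition alexander (p q n : nat) (G : grid p n) (x : generator p n) : rat :=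
  2^-1 * (maslov_of q (OO G) x - maslov_of q (XX G) x - (n%:R - 1)).

Definition has_degree (p q n : nat) (G : grid p n) (c : chain p n)
    (s : int) (m a : rat) : Prop :=
  c != 0 /\ forall x : generator p n, c x != 0 ->
    [/\ spin q G x = s, maslov q G x = m & alexander q G x = a].

(* The e i are homogeneous cycles whose classes form a basis of
   ker / im of the differential. *)
Definition homogeneous_homology_basis (p q n : nat) (G : grid p n) (r : nat)
    (e : 'I_r -> chain p n) : Prop :=
  let Z := lker (differential q G) in
  let B := limg (differential q G) in
  [/\ forall i, e i \in Z,
      forall i, exists s m a, has_degree q G (e i) s m a,
      forall c : 'I_r -> 'F_2,
        \sum_(i < r) c i *: e i \in B -> forall i, c i = 0 &
      forall z, z \in Z ->
        exists c : 'I_r -> 'F_2, z - \sum_(i < r) c i *: e i \in B].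

(* Main.v *)
(** The complexes of G and -G coincide, M_X = M - 2A - (n-1), exchanging O and X
    turns A into -A - (n-1), and it changes the spin degree by a constant.  So one
    homogeneous basis of the homology serves both sides, once such a basis
    exists; for this it suffices that the differential maps each homogeneous
    generator into a single degree, injectively on degrees.

    A parallelogram P from x to y without markings preserves the spin degree, and
    lowers M_O and M_X by 1.  For the latter, lift everything to the N x N torus,
    N = pn, where every row and every column meets the lift of a generator or of
    a marking once.  There y - x is, up to sign, a sum of p products of differences of
    delta functions, and the partial sums in I telescope: the change of I is minus
    the number of points in half-open copies of P, up to wrap-around terms that
    cancel.  The admissible P contains one point of x when its upper and right
    sides are removed, and no point of y when its lower and left sides are. *)

Require Import Defs.
From mathcomp Require Import all_boot all_order all_algebra.
From mathcomp Require Import ring lra zify.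

Set Implicit Arguments.
Unset Strict Implicit.
Unset Printing Implicit Defensive.

Import Order.TTheory GRing.Theory Num.Theory.
Local Open Scope ring_scope.

(** * Homogeneous bases of a kernel modulo a subspace *)

(** A vector of [s] is kept only if it lies outside the span of the vectors kept so far plus [B].
    The selection takes members of [s] itself, so it stays homogeneous when [s] is. *)
Lemma complement_basis (K : fieldType) (V : vectType K) (B : {vspace V})
    (s : seq V) :
  exists t : seq V, [/\ {subset t <= s},
    forall c : 'I_(size t) -> K,
      \sum_(i < size t) c i *: t`_i \in B -> forall i, c i = 0 &
    (<<s>> <= <<t>> + B)%VS].
Proof.
elim: s => [|v s [t [sub_ts free_t span_t]]].
  exists [::]; split=> [//|c _ [] //|].
  by rewrite span_nil sub0v.
have [v_in|v_notin] := boolP (v \in (<<t>> + B)%VS).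
  exists t; split=> //.
    by move=> w /sub_ts wt; rewrite inE wt orbT.
  by rewrite span_cons subv_add span_t andbT -memvE.
exists (v :: t); split.
- move=> w; rewrite !inE => /orP[->//|/sub_ts ->]; exact: orbT.
- move=> c; rewrite big_ord_recl /= => cB.
  have c0 : c ord0 = 0.
    apply/eqP; apply: contraR v_notin => c0n.
    have tsum : \sum_(i < size t) c (lift ord0 i) *: t`_i \in <<t>>%VS.
      by apply: memv_suml => i _; apply/memvZ/memv_span/mem_nth.
    (* Dividing the relation by [c ord0] would put [v] in [<<t>> + B]. *)
    rewrite -[v](scalerK c0n) memvZ //.
    rewrite -[X in X \in _](addrK (\sum_(i < size t) c (lift ord0 i) *: t`_i)).
    rewrite rpredB //; last exact: (subvP (addvSl _ _)).
    exact: (subvP (addvSr _ _)).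
  move: cB; rewrite c0 scale0r add0r => /free_t cl i.
  by have [j ->|->//] := unliftP ord0 i.
- rewrite !span_cons subv_add; apply/andP; split.
    by rewrite -addvA addvSl.
  by rewrite -addvA; apply: (subv_trans span_t); exact: addvSr.
Qed.

Section HomogeneousKernel.
Variables (K : fieldType) (T : finType) (I : eqType).
Variables (D : 'End({ffun T -> K^o})) (a : T -> T -> K).
Hypothesis DE : forall c y, D c y = \sum_x c x * a x y.
Variables (deg : T -> I) (tau : I -> I).
Hypothesis tau_inj : injective tau.
Hypothesis a_deg : forall x y, a x y != 0 -> deg y = tau (deg x).

Definition homogeneous_part (k : I) (c : {ffun T -> K^o}) : {ffun T -> K^o} :=
  [ffun x => if deg x == k then c x else 0].

(** By injectivity of [tau], only the part of degree [k] reaches degree [tau k]. So each coordinate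
    of the image of this part is either the one of [D c] or zero. *)
Lemma homogeneous_part_ker k c :
  c \in lker D -> homogeneous_part k c \in lker D.
Proof.
rewrite !memv_ker => /eqP Dc; apply/eqP/ffunP => y.
have := congr1 (fun f : {ffun T -> K^o} => f y) Dc; rewrite !DE !ffunE => Dcy.
have [ydeg|ydeg] := eqVneq (deg y) (tau k).
  rewrite -[RHS]Dcy; apply: eq_bigr => x _; rewrite ffunE.
  case: eqP => // xk; have [->|/a_deg] := eqVneq (a x y) 0; first by rewrite !mulr0.
  by rewrite ydeg => /tau_inj /esym.
apply: big1 => x _; rewrite ffunE; case: eqP => [xk|]; last by rewrite mul0r.
have [->|/a_deg] := eqVneq (a x y) 0; first by rewrite mulr0.
by rewrite xk => /eqP; rewrite (negPf ydeg).
Qed.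

Lemma sum_homogeneous_part c :
  \sum_(k <- undup [seq deg x | x <- enum T]) homogeneous_part k c = c.
Proof.
apply/ffunP => x; rewrite sum_ffunE.
have x_deg : deg x \in undup [seq deg x | x <- enum T].
  by rewrite mem_undup map_f ?mem_enum.
rewrite (bigD1_seq (deg x)) ?undup_uniq //= ffunE eqxx big1 ?addr0 // => k.
by rewrite eq_sym ffunE => /negPf ->.
Qed.

(** The homogeneous parts of a basis of the kernel lie in the kernel and span it, so
    [complement_basis] can choose among them. *)
Lemma homogeneous_complement (B : {vspace {ffun T -> K^o}}) :
  exists (r : nat) (e : 'I_r -> {ffun T -> K^o}), [/\
    forall i, e i \in lker D,
    forall i, e i != 0 /\ exists k, forall x, e i x != 0 -> deg x = k,
    forall c : 'I_r -> K, \sum_(i < r) c i *: e i \in B -> forall i, c i = 0 &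
    forall z, z \in lker D ->
      exists c : 'I_r -> K, z - \sum_(i < r) c i *: e i \in B].
Proof.
pose ks := undup [seq deg x | x <- enum T].
pose s := [seq homogeneous_part k b | k <- ks, b <- vbasis (lker D)].
have [t [sub_ts free_t span_t]] := complement_basis B s.
exists (size t), (fun i => t`_i); split.
- move=> i; have /sub_ts/allpairsP[[k b] /= [_ bD ->]] := mem_nth 0 (ltn_ord i).
  by apply: homogeneous_part_ker; exact: vbasis_mem.
- move=> i; split.
    (* A zero vector would satisfy the relation with coefficients [j == i], against independence
       modulo [B]. *)
    apply/eqP => ti0.
    suff: (i == i)%:R = 0 :> K by rewrite eqxx => /eqP; rewrite oner_eq0.
    apply: (free_t (fun j => (j == i)%:R)); rewrite big1 ?mem0v // => j _.
    by case: eqP => [->|_]; rewrite ?ti0 ?scaler0 ?scale0r.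
  have /sub_ts/allpairsP[[k b] /= [_ _ ->]] := mem_nth 0 (ltn_ord i).
  by exists k => x; rewrite ffunE; case: (deg x =P k) => // _; rewrite eqxx.
- exact: free_t.
- move=> z zD; have zs : z \in <<s>>%VS.
    rewrite -(sum_homogeneous_part z) big_seq; apply: memv_suml => k kks.
    rewrite (coord_vbasis zD).
    have -> : homogeneous_part k
        (\sum_(i < \dim (lker D)) coord (vbasis (lker D)) i z *: (vbasis (lker D))`_i)
      = \sum_(i < \dim (lker D)) coord (vbasis (lker D)) i z *:
          homogeneous_part k (vbasis (lker D))`_i.
      apply/ffunP => x; rewrite !ffunE !sum_ffunE.
      case: ifP => kx; last first.
        by rewrite big1 // => i _; rewrite !ffunE kx scaler0.
      by apply: eq_bigr => i _; rewrite !ffunE kx.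
    apply: memv_suml => i _; apply/memvZ/memv_span/allpairs_f => //.
    by apply: mem_nth; rewrite size_tuple.
  have /memv_addP[u ut [b bB zE]] := subvP span_t _ zs.
  exists (fun i => coord (in_tuple t) i u).
  have -> : \sum_(i < size t) coord (in_tuple t) i u *: t`_i = u.
    by rewrite [RHS](coord_span (X := in_tuple t) ut).
  by rewrite zE addrC addKr.
Qed.

End HomogeneousKernel.

(** * Markings as generators *)

(** There are [n] cells in distinct rows among [n] rows, so every row is met exactly once; likewise
    for columns. The lift arguments for generators thereby apply to markings. *)
Lemma marking_generator (p n : nat) (A : {set point p n}) :
  (0 < n)%N -> is_marking A -> is_generator A.
Proof.
move=> n_gt0 [cardA row_inj col_inj].
have once (g : point p n -> 'I_n) : {in A &, injective g} ->
    forall i, #|[set z in A | g z == i]| = 1%N.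
  move=> g_inj i.
  have gA : g @: A = setT.
    by apply/eqP; rewrite eqEcard subsetT cardsT card_ord card_in_imset // cardA /=.
  have /imsetP[z zA iE] : i \in g @: A by rewrite gA inE.
  apply/eqP/cards1P; exists z; apply/setP => t; rewrite !inE.
  apply/andP/eqP => [[tA /eqP gt]|->]; last by rewrite zA iE eqxx.
  by apply: g_inj => //; rewrite gt iE.
apply/andP; split; apply/forallP => i.
  by apply/eqP; apply: once.
apply/eqP; rewrite -(once (fun z => Ordinal (ltn_pmod z.1 n_gt0)) _ i).
  by congr #|pred_of_set _|; apply/setP => z; rewrite !inE.
by move=> z t zA tA /(congr1 val); apply: col_inj.
Qed.

Lemma card1_witness (T : finType) (A : {set T}) (P : pred T) :
  #|[set z in A | P z]| == 1%N ->
  exists z, [/\ z \in A, P z & forall t, t \in A -> P t -> t = z].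
Proof.
move=> /cards1P[z zE]; exists z.
have : z \in [set z in A | P z] by rewrite zE inE.
rewrite inE => /andP[zA Pz]; split=> // t tA Pt.
by apply/set1P; rewrite -zE inE tA.
Qed.

(** * Lifts of point sets to the N x N torus *)

Section Lattice.
Variables p q n : nat.
Local Notation N := (p * n)%N.
Local Notation lat := (lattice p q n).
Implicit Types (A x y : {set point p n}) (z t : point p n).

Lemma latticeP (u v : int) :
  reflect (exists k l : int, u = q%:Z * n%:Z * l + N%:Z * k /\ v = n%:Z * l)
          (lat u v).
Proof.
apply: (iffP andP) => [[/dvdzP[l ->] /dvdzP[k uE]]|[k [l [-> ->]]]].
  exists k, l; split; last exact: mulrC.
  by rewrite [X in _ + X]mulrC -uE; ring.
split; first exact: dvdz_mulr.
by apply/dvdzP; exists k; ring.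
Qed.

Lemma latticeD (u v u' v' : int) : lat u v -> lat u' v' -> lat (u + u') (v + v').
Proof.
move=> /latticeP[k [l [-> ->]]] /latticeP[k' [l' [-> ->]]].
by apply/latticeP; exists (k + k'), (l + l'); split; ring.
Qed.

Lemma latticeN (u v : int) : lat u v -> lat (- u) (- v).
Proof.
move=> /latticeP[k [l [-> ->]]].
by apply/latticeP; exists (- k), (- l); split; ring.
Qed.

Lemma latticeB (u v u' v' : int) : lat u v -> lat u' v' -> lat (u - u') (v - v').
Proof. by move=> uv /latticeN; apply: latticeD. Qed.

(** The position [(u, v)] in the plane is a lift of the point [z] of the torus. *)
Definition sits z (u v : nat) : bool :=
  lat (z.1%:Z - u%:Z) (z.2%:Z - v%:Z).

Lemma small_multiple (m : nat) (i j : 'I_m) (k : int) :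
  i%:Z - j%:Z = m%:Z * k -> i = j.
Proof.
move=> ijk; apply: val_inj; have := ltn_ord i; have := ltn_ord j => /=.
have [/eqP k0|k0] := boolP (k == 0); first by move: ijk; rewrite k0; lia.
by nia.
Qed.

(** The representatives in [[0, N) x [0, n)] form a fundamental domain: the second coordinates force
    [l = 0], and then the first ones agree. *)
Lemma sits_inj z t u v : sits z u v -> sits t u v -> z = t.
Proof.
move=> zu tu; have /latticeP[k [l [e1 e2]]] := latticeB zu tu.
have z2 : z.2 = t.2 by apply: (@small_multiple _ _ _ l); rewrite -e2; ring.
have n_gt0 : (0 < n)%N by apply: leq_ltn_trans (ltn_ord z.2).
have l0 : l = 0.
  apply/eqP; have /eqP : n%:Z * l = 0 by rewrite -e2 z2; ring.
  by rewrite mulf_eq0; lia.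
case: z t z2 e1 {e2 zu tu} => z1 z2 [t1 t2] /= -> e1; congr (_, _).
apply: (@small_multiple _ _ _ k); move: e1; rewrite l0 => e1.
by transitivity (z1%:Z - u%:Z - (t1%:Z - u%:Z)); [ring|rewrite e1 mulr0 add0r].
Qed.

Definition lifted A (u v : nat) : bool := [exists z in A, sits z u v].

Lemma liftedP A u v : reflect (exists2 z, z \in A & sits z u v) (lifted A u v).
Proof. exact: exists_inP. Qed.

Lemma sits_lattice z (u v u' v' : nat) :
  lat (u%:Z - u'%:Z) (v%:Z - v'%:Z) -> sits z u v = sits z u' v'.
Proof.
move=> uu; apply/idP/idP => [zu|zu].
  have := latticeD zu uu; rewrite /sits.
  by congr lattice; ring.
have := latticeB zu uu; rewrite /sits.
by congr lattice; ring.
Qed.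

Lemma lifted_lattice A (u v u' v' : nat) :
  lat (u%:Z - u'%:Z) (v%:Z - v'%:Z) -> lifted A u v = lifted A u' v'.
Proof.
by move=> uu; apply: eq_existsb => z; rewrite (sits_lattice z uu).
Qed.

Lemma modn_sub_int (u m : nat) : (u %% m)%N%:Z - u%:Z = - (m%:Z * (u %/ m)%N%:Z).
Proof. by rewrite {2}(divn_eq u m) PoszD PoszM; ring. Qed.

(** Both [(N, 0)] and [(0, N) = p (nq, n) - q (N, 0)] are lattice vectors. *)
Lemma lifted_mod A u v : lifted A (u %% N) (v %% N) = lifted A u v.
Proof.
apply: lifted_lattice; apply/latticeP; rewrite !modn_sub_int.
exists (q%:Z * (v %/ N)%N%:Z - (u %/ N)%N%:Z), (- (p%:Z * (v %/ N)%N%:Z)).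
by rewrite PoszM; split; ring.
Qed.

Lemma lifted_shift A u v k :
  lifted A (u + n * q * k) (v + n * k) = lifted A u v.
Proof.
apply: lifted_lattice; apply/latticeP.
exists 0, k%:Z; rewrite !PoszD !PoszM; split; ring.
Qed.

Lemma lifted_sum A u v : ((lifted A u v)%:R : rat) = \sum_(z in A) (sits z u v)%:R.
Proof.
have [/liftedP[z zA zu]|/exists_inPn nA] := boolP (lifted A u v).
  rewrite (bigD1 z) //= zu big1 ?addr0 // => t /andP[tA tz].
  by case tu: (sits t u v) => //; rewrite (sits_inj tu zu) eqxx in tz.
by rewrite big1 // => z /nA /negPf ->.
Qed.

Hypotheses (p_gt0 : (0 < p)%N) (n_gt0 : (0 < n)%N).

Let N_gt0 : (0 < N)%N. Proof. by rewrite muln_gt0 p_gt0. Qed.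

Lemma sum_residue (P : nat -> bool) (m : int) :
  (forall u, (u < N)%N -> P u = (N%:Z %| u%:Z - m)%Z) ->
  \sum_(u < N) (P u)%:R = 1 :> rat.
Proof.
move=> PE.
have Nn0 : N%:Z != 0 by rewrite eqz_nat -lt0n.
have m_ge0 := modz_ge0 m Nn0.
have m_lt : (`|(m %% N%:Z)%Z| < N)%N by have := ltz_pmod m (d := N%:Z); lia.
rewrite (bigD1 (Ordinal m_lt)) //= PE // -eqz_mod_dvd.
rewrite gez0_abs // modz_mod eqxx big1 ?addr0 // => u /eqP um.
rewrite PE // -eqz_mod_dvd; case: eqP => // um'; case: um; apply: val_inj => /=.
by rewrite -um' modz_nat absz_nat modn_small.
Qed.

Lemma generator_row A v : is_generator A ->
  exists z, [/\ z \in A, (n%:Z %| z.2%:Z - v%:Z)%Z &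
    forall t, t \in A -> (n%:Z %| t.2%:Z - v%:Z)%Z -> t = z].
Proof.
move=> /andP[/forallP rows _].
have := rows (Ordinal (ltn_pmod v n_gt0)); move=> /card1_witness[z [zA zv uz]].
have rowE t : (n%:Z %| t.2%:Z - v%:Z)%Z = (t.2 == Ordinal (ltn_pmod v n_gt0)).
  by rewrite -eqz_mod_dvd !modz_nat eqz_nat (modn_small (ltn_ord t.2)).
exists z; rewrite rowE; split=> // t tA; rewrite rowE => /uz; exact.
Qed.

Lemma generator_col A u : is_generator A ->
  exists z, [/\ z \in A, (n%:Z %| z.1%:Z - u%:Z)%Z &
    forall t, t \in A -> (n%:Z %| t.1%:Z - u%:Z)%Z -> t = z].
Proof.
move=> /andP[_ /forallP cols].
have := cols (Ordinal (ltn_pmod u n_gt0)); move=> /card1_witness[z [zA zu uz]].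
have colE t :
    (n%:Z %| t.1%:Z - u%:Z)%Z = (t.1 %% n == Ordinal (ltn_pmod u n_gt0))%N.
  by rewrite -eqz_mod_dvd !modz_nat eqz_nat.
exists z; rewrite colE; split=> // t tA; rewrite colE => /uz; exact.
Qed.

Lemma sits_row z u v : sits z u v -> (n%:Z %| z.2%:Z - v%:Z)%Z.
Proof. by case/andP. Qed.

Lemma sits_col z u v : sits z u v -> (n%:Z %| z.1%:Z - u%:Z)%Z.
Proof.
move=> /latticeP[k [l [-> _]]]; apply/dvdzP; exists (q%:Z * l + p%:Z * k).
by rewrite PoszM; ring.
Qed.

(** Only the point of [A] in the row of [v] modulo [n] has lifts at height [v], and these differ by
    multiples of [(N, 0)]. *)
Lemma lifted_row_sum A v : is_generator A ->
  \sum_(u < N) (lifted A u v)%:R = 1 :> rat.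
Proof.
move=> /(@generator_row _ v)[z [zA zv uz]].
apply: (@sum_residue (fun u => lifted A u v) (z.1%:Z - q%:Z * (z.2%:Z - v%:Z))) => u _.
transitivity (sits z u v).
  by apply/liftedP/idP => [[t tA tu]|]; [rewrite -(uz t tA (sits_row tu))|exists z].
rewrite /sits /lattice zv /= !dvdzE -[X in (_ %| X)%N = _]abszN; congr (_ %| `|_|)%N; ring.
Qed.

Lemma sits_trans z (a b u v : nat) : sits z a b ->
  sits z u v = lat (u%:Z - a%:Z) (v%:Z - b%:Z).
Proof.
move=> zab; apply/idP/idP => [zu|uv].
  have := latticeB zab zu; congr lattice; ring.
by rewrite (sits_lattice z uv).
Qed.

(** Modulo N in both coordinates the lattice is cyclic of order [p], generated by [(nq, n)]; hence
    the translates of one lift of [z] by its multiples are all the lifts. *)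
Lemma sum_fiber z (a b : nat) (f : nat -> nat -> rat) : sits z a b ->
  \sum_(w : 'I_N * 'I_N) (sits z w.1 w.2)%:R * f w.1 w.2 =
  \sum_(k < p) f ((a + n * q * k) %% N)%N ((b + n * k) %% N)%N.
Proof.
move=> zab.
pose h (k : 'I_p) : 'I_N * 'I_N :=
  (Ordinal (ltn_pmod (a + n * q * k) N_gt0), Ordinal (ltn_pmod (b + n * k) N_gt0)).
have h_inj : injective h.
  move=> k l [_ /eqP]; rewrite -eqz_nat -!modz_nat eqz_mod_dvd => /dvdzP[c e].
  apply: (@small_multiple _ _ _ c).
  apply: (mulIf (x := n%:Z)); first by rewrite eqz_nat -lt0n.
  transitivity ((b + n * k)%N%:Z - (b + n * l)%N%:Z).
    by rewrite !(PoszM, PoszD); ring.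
  by rewrite e PoszM; ring.
transitivity (\sum_(w in [set h k | k in 'I_p]) f w.1 w.2); last first.
  by rewrite big_imset //= => k l _ _; apply: h_inj.
rewrite [RHS]big_mkcond; apply: eq_bigr => w _.
rewrite (_ : sits z w.1 w.2 = (w \in [set h k | k in 'I_p])).
  by case: ifP => _; rewrite ?mul1r ?mul0r.
rewrite (sits_trans _ _ zab); apply/latticeP/imsetP => [[k [l [e1 e2]]]|[k _ ->]].
  have pn0 : p%:Z != 0 by rewrite eqz_nat -lt0n.
  (* The index of the translate is the coefficient [l] of [(nq, n)] reduced modulo [p]. *)
  have l_ge0 := modz_ge0 l pn0.
  have l_lt : (`|(l %% p%:Z)%Z| < p)%N by have := ltz_pmod l (d := p%:Z); lia.
  exists (Ordinal l_lt) => //; case: w e1 e2 => [u v] /= e1 e2.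
  have lE := divz_eq l p.
  congr (_, _); apply: val_inj => /=.
    apply/eqP; rewrite -[X in (X == _)%N](modn_small (ltn_ord u)) -eqz_nat -!modz_nat.
    rewrite eqz_mod_dvd !(PoszM, PoszD) gez0_abs //; apply/dvdzP.
    exists (k + q%:Z * (l %/ p%:Z)%Z).
    rewrite opprD addrA e1 [in LHS](PoszM p n) {1}lE; ring.
  apply/eqP; rewrite -[X in (X == _)%N](modn_small (ltn_ord v)) -eqz_nat -!modz_nat.
  rewrite eqz_mod_dvd !(PoszM, PoszD) gez0_abs //; apply/dvdzP.
  exists (l %/ p%:Z)%Z.
  rewrite opprD addrA e2 {1}lE; ring.
exists (q%:Z * ((b + n * k) %/ N)%N%:Z - ((a + n * q * k) %/ N)%N%:Z),
  (k%:Z - p%:Z * ((b + n * k) %/ N)%N%:Z).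
have H u : (u %% N)%N%:Z = u%:Z - N%:Z * (u %/ N)%N%:Z.
  by rewrite -[LHS](subrK u%:Z) modn_sub_int; ring.
by rewrite /= !H !(PoszM, PoszD); split; ring.
Qed.

Hypothesis copq : coprime p q.

(** Reaching column [u] from [z] requires [s = q l + p k]. As [q] is invertible modulo [p], this
    determines [l] modulo [p], hence the height modulo N. *)
Lemma lifted_col_sum A u : is_generator A ->
  \sum_(v < N) (lifted A u v)%:R = 1 :> rat.
Proof.
move=> /(@generator_col _ u)[z [zA /dvdzP[s sE] uz]].
(* The Bezout coefficient [c] is an inverse of [q] modulo [p]. *)
have [[b c] /= bqc] := coprimezP p q copq.
apply: (@sum_residue (fun v => lifted A u v) (z.2%:Z - n%:Z * (c * s))) => v _.
transitivity (sits z u v).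
  apply/liftedP/idP => [[t tA tu]|]; [rewrite -(uz t tA) //|by exists z].
  exact: sits_col tu.
have bqc' : b * p%:Z + c * q%:Z = 1 by [].
apply/latticeP/dvdzP => [[k [l [e1 e2]]]|[k e]].
  have sl : s = q%:Z * l + p%:Z * k.
    apply: (mulIf (x := n%:Z)); first by rewrite eqz_nat -lt0n.
    by rewrite -sE e1 PoszM; ring.
  exists (c * k - b * l); rewrite PoszM.
  have -> : v%:Z = z.2%:Z - n%:Z * l by rewrite -e2; ring.
  have -> : n%:Z * l = n%:Z * l * (b * p%:Z + c * q%:Z) by rewrite bqc' mulr1.
  by rewrite sl; ring.
have vE : v%:Z = z.2%:Z - n%:Z * (c * s) + k * N%:Z by rewrite -e; ring.
exists (b * s + q%:Z * k), (c * s - p%:Z * k); rewrite sE vE PoszM; split; last by ring.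
have -> : s * n%:Z = s * n%:Z * (b * p%:Z + c * q%:Z) by rewrite bqc' mulr1.
by ring.
Qed.

End Lattice.

(** * Sums over lifts, the Maslov degree as such a sum, and telescoping *)

Section LiftSum.
Variables p q n : nat.
Local Notation N := (p * n)%N.
Implicit Types (A B x y M : {set point p n}) (z t : point p n) (f : nat -> nat -> rat).

Definition liftsum A f : rat :=
  \sum_(w : 'I_N * 'I_N) (lifted q A w.1 w.2)%:R * f w.1 w.2.

Lemma eq_liftsum A f g :
  (forall u v, (u < N)%N -> (v < N)%N -> f u v = g u v) -> liftsum A f = liftsum A g.
Proof. by move=> fg; apply: eq_bigr => w _; rewrite fg. Qed.

Lemma liftsumB A f g :
  liftsum A (fun u v => f u v - g u v) = liftsum A f - liftsum A g.
Proof. by rewrite /liftsum -sumrB; apply: eq_bigr => w _; rewrite mulrBr. Qed.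

Lemma liftsumD A f g :
  liftsum A (fun u v => f u v + g u v) = liftsum A f + liftsum A g.
Proof. by rewrite /liftsum -big_split; apply: eq_bigr => w _; rewrite mulrDr. Qed.

Lemma exchange_liftsum A B (F : nat -> nat -> nat -> nat -> rat) :
  liftsum A (fun u v => liftsum B (F u v)) =
  liftsum B (fun u' v' => liftsum A (fun u v => F u v u' v')).
Proof.
rewrite /liftsum.
under eq_bigr => w _ do rewrite mulr_sumr.
rewrite exchange_big /=; apply: eq_bigr => w' _; rewrite mulr_sumr.
by apply: eq_bigr => w _; rewrite mulrCA.
Qed.

Lemma liftsum_sits A f :
  liftsum A f =
  \sum_(z in A) \sum_(w : 'I_N * 'I_N) (sits q z w.1 w.2)%:R * f w.1 w.2.
Proof.
rewrite exchange_big; apply: eq_bigr => w _.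
by rewrite lifted_sum mulr_suml.
Qed.

Hypotheses (p_gt0 : (0 < p)%N) (n_gt0 : (0 < n)%N).

Let N_gt0 : (0 < N)%N. Proof. by rewrite muln_gt0 p_gt0. Qed.

Lemma rat_mod_nat (m d : nat) (eps : rat) : (0 < d)%N -> 0 <= eps < 1 ->
  rat_mod (m%:R + eps) d%:R = (m %% d)%:R + eps.
Proof.
move=> d_gt0 /andP[eps_ge0 eps_lt1]; rewrite /rat_mod.
have d_gt0' : 0 < d%:R :> rat by rewrite ltr0n.
have mE : m%:R = d%:R * (m %/ d)%:R + (m %% d)%:R :> rat.
  by rewrite {1}(divn_eq m d) natrD natrM mulrC.
have md : (m %% d)%:R + 1 <= d%:R :> rat by rewrite natr1 ler_nat ltn_pmod.
have m_ge0 : 0 <= (m %% d)%:R :> rat by rewrite ler0n.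
rewrite (@Num.Theory.floor_def _ _ (m %/ d)%N%:Z).
  by rewrite mE -pmulrn; ring.
rewrite ler_pdivlMr // ltr_pdivrMr // intrD -!pmulrn mE; apply/andP; split; nra.
Qed.

(** The map [C_lift] lists exactly the [p] lifts given by [sum_fiber]; [eps] is 0 for generators and
    1/2 for markings. *)
Lemma sum_C_lift A (eps : rat) (F : rat * rat -> rat) : 0 <= eps < 1 ->
  \sum_(u <- C_lift p q n
     [seq ((nat_of_ord z.1)%:R + eps, (nat_of_ord z.2)%:R + eps) | z <- enum A]) F u =
  liftsum A (fun u v => F (u%:R + eps, v%:R + eps)).
Proof.
move=> eps01; rewrite liftsum_sits /C_lift big_allpairs_dep big_map big_enum /=.
apply: eq_bigr => z _.
have zz : sits q z z.1 z.2 by apply/latticeP; exists 0, 0; split; ring.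
rewrite (sum_fiber p_gt0 n_gt0 (fun u v => F (u%:R + eps, v%:R + eps)) zz).
rewrite -[in iota 0 p](subn0 p) -/(index_iota 0 p) big_mkord.
apply: eq_bigr => k _; congr (F (_, _)).
  by rewrite -addrA (addrC eps) addrA -natrD (mulnC n p) rat_mod_nat.
(* [C_lift] does not reduce the second coordinate, but it is already below N. *)
have zk : (z.2 + n * k < N)%N.
  by have := ltn_ord k; have := ltn_ord z.2; nia.
by rewrite /= -addrA (addrC eps) addrA -natrD modn_small.
Qed.

Lemma II_C_lift A B (eps eps' : rat) (r : rel nat) :
  0 <= eps < 1 -> 0 <= eps' < 1 ->
  (forall u v : nat, (u%:R + eps < v%:R + eps') = r u v) ->
  (II (C_lift p q n
         [seq ((nat_of_ord z.1)%:R + eps, (nat_of_ord z.2)%:R + eps) | z <- enum A])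
      (C_lift p q n
         [seq ((nat_of_ord z.1)%:R + eps', (nat_of_ord z.2)%:R + eps') | z <- enum B]))%:R
  = liftsum A (fun u v => liftsum B (fun u' v' => (r u u')%:R * (r v v')%:R)).
Proof.
move=> eps01 eps'01 rE; rewrite /II natr_sum.
under eq_bigr => u _ do rewrite natr_sum sum_C_lift //.
rewrite sum_C_lift //; apply: eq_liftsum => u v _ _; apply: eq_liftsum => u' v' _ _.
by rewrite /= !rE -mulnb natrM.
Qed.

Lemma W_pointsE A :
  W_points A = [seq ((nat_of_ord z.1)%:R + 0, (nat_of_ord z.2)%:R + 0) | z <- enum A].
Proof. by apply: eq_map => z; rewrite !addr0. Qed.

Definition before (r : rel nat) A B : rat :=
  liftsum A (fun u v => liftsum B (fun u' v' => (r u u')%:R * (r v v')%:R)).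

(** The half-integer offset of the markings turns the comparison of a generator point with a marking
    into [leq]; the three other comparisons are [ltn] on cell corners. *)
Lemma maslov_ofE M (x : generator p n) :
  maslov_of q M x =
  p%:R^-1 * (before ltn (val x) (val x) - before leq (val x) M
             - before ltn M (val x) + before ltn M M + 1)
  + d_inv p q q.-1 + (p%:R - 1) / p%:R.
Proof.
rewrite /maslov_of /before W_pointsE /W_markings.
have half01 : (0 <= 2^-1 :> rat) && (2^-1 < 1 :> rat) by lra.
have zero01 : (0 <= 0 :> rat) && (0 < 1 :> rat) by lra.
have ltn_half (u v : nat) : (u%:R + 2^-1 < v%:R + 0 :> rat) = (u < v)%N.
  rewrite addr0; case: (ltnP u v) => uv; last first.
    by move: uv; rewrite -(ler_nat rat) => uv; apply/negbTE; rewrite -leNgt; lra.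
  by move: uv; rewrite -(ler_nat rat) -natr1 => uv; lra.
have leq_half (u v : nat) : (u%:R + 0 < v%:R + 2^-1 :> rat) = (u <= v)%N.
  rewrite addr0; case: (leqP u v) => uv; last first.
    by move: uv; rewrite -(ler_nat rat) -natr1 => uv; apply/negbTE; rewrite -leNgt; lra.
  by move: uv; rewrite -(ler_nat rat) => uv; lra.
rewrite (II_C_lift (r := ltn) _ _ zero01 zero01); last first.
  by move=> u v; rewrite ltrD2r ltr_nat.
rewrite (II_C_lift (r := leq) _ _ zero01 half01) //.
rewrite (II_C_lift (r := ltn) _ _ half01 zero01) //.
rewrite (II_C_lift (r := ltn) _ _ half01 half01) // => u v.
by rewrite ltrD2r ltr_nat.
Qed.

(* [phi a] is the indicator of the coordinates after, not before, or before [a];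
   replacing [a] by [a + 1] changes it at one coordinate only, except for the
   constant arising when the representative in [0, N) wraps around. *)
Definition steps (phi : nat -> nat -> rat) (sgn : rat) (d : nat) : Prop :=
  forall a u, (u < N)%N ->
    phi (a %% N)%N u - phi (a.+1 %% N)%N u =
    sgn * ((u == (a + d) %% N)%N%:R - (a.+1 %% N == 0)%N%:R).

Lemma modn_succ a : (a.+1 %% N = if (a %% N).+1 == N then 0 else (a %% N).+1)%N.
Proof.
rewrite -addn1 -modnDml addn1; case: eqP => [->|]; first by rewrite modnn.
by have := ltn_pmod a N_gt0 => aN an; rewrite modn_small //; lia.
Qed.

(** When [a] becomes [a + 1], the indicator of [a < u] changes at [u = a + 1], those of [a <= u] and
    [u < a] at [u = a]. The offset [d] later decides which sides of a rectangle are counted. *)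
Lemma steps_ltn : steps (fun a u => (a < u)%N%:R) 1 1.
Proof.
move=> a u uN; rewrite addn1 modn_succ; have := ltn_pmod a N_gt0.
set b := (a %% N)%N => bN; have [bN'|bN'] := eqVneq b.+1 N.
  by case: (ltngtP b u); case: (ltngtP 0 u); case: eqP; rewrite /=; try lia; lra.
by case: (ltngtP b u); case: (ltngtP b.+1 u); case: eqP; rewrite /=; try lia; lra.
Qed.

Lemma steps_leq : steps (fun a u => (a <= u)%N%:R) 1 0.
Proof.
move=> a u uN; rewrite addn0 modn_succ; have := ltn_pmod a N_gt0.
set b := (a %% N)%N => bN; have [bN'|bN'] := eqVneq b.+1 N.
  by case: (ltngtP b u); case: (ltngtP 0 u); rewrite /=; try lia; lra.
by case: (ltngtP b u); case: (ltngtP b.+1 u); rewrite /=; try lia; lra.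
Qed.

Lemma steps_gtn : steps (fun a u => (u < a)%N%:R) (-1) 0.
Proof.
move=> a u uN; rewrite addn0 modn_succ; have := ltn_pmod a N_gt0.
set b := (a %% N)%N => bN; have [bN'|bN'] := eqVneq b.+1 N.
  by case: (ltngtP b u); rewrite /=; try lia; lra.
by case: (ltngtP b u); case: (ltngtP u b.+1); rewrite /=; try lia; lra.
Qed.

(** The number of multiples of N passed in [w] steps from [a]. *)
Definition wraps (a w : nat) : rat := \sum_(i < w) ((a + i).+1 %% N == 0)%N%:R.

Lemma steps_sum phi sgn d a w u : steps phi sgn d -> (u < N)%N ->
  phi (a %% N)%N u - phi ((a + w) %% N)%N u =
  sgn * (\sum_(i < w) (u == (a + i + d) %% N)%N%:R - wraps a w).
Proof.
move=> phi_steps uN; rewrite /wraps -sumrB.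
elim: w => [|w IHw]; first by rewrite big_ord0 addn0 subrr mulr0.
by rewrite big_ord_recr mulrDr -IHw -phi_steps // addnS; ring.
Qed.

Lemma sum_single (F : nat -> rat) m :
  \sum_(u < N) F u * (u == m %% N :> nat)%N%:R = F (m %% N)%N.
Proof.
rewrite (bigD1 (Ordinal (ltn_pmod m N_gt0))) //= eqxx mulr1 big1 ?addr0 // => u.
by rewrite -val_eqE => /negPf /= ->; rewrite mulr0.
Qed.

Lemma liftsum_single A a b :
  liftsum A (fun u v => (u == a %% N)%N%:R * (v == b %% N)%N%:R) = (lifted q A a b)%:R.
Proof.
rewrite /liftsum -(pair_bigA _ (fun u v : 'I_N => (lifted q A u v)%:R *
   ((u == a %% N :> nat)%N%:R * (v == b %% N :> nat)%N%:R))) /=.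
rewrite -lifted_mod -(sum_single (fun u => (lifted q A u (b %% N))%:R)).
apply: eq_bigr => u _; rewrite -(sum_single (fun v => (lifted q A u v)%:R)) mulr_suml.
by apply: eq_bigr => v _; ring.
Qed.

Lemma liftsum_sum A (I : finType) (F : I -> nat -> nat -> rat) :
  liftsum A (fun u v => \sum_i F i u v) = \sum_i liftsum A (F i).
Proof.
by rewrite /liftsum exchange_big; apply: eq_bigr => w _; rewrite mulr_sumr.
Qed.

Lemma liftsumZ A c f : liftsum A (fun u v => c * f u v) = c * liftsum A f.
Proof. by rewrite /liftsum mulr_sumr; apply: eq_bigr => w _; rewrite mulrCA. Qed.

Hypothesis copq : coprime p q.

Lemma liftsum_col A a : is_generator A ->
  liftsum A (fun u _ => (u == a %% N)%N%:R) = 1.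
Proof.
move=> genA; rewrite /liftsum -(pair_bigA _ (fun u v : 'I_N => (lifted q A u v)%:R *
   (u == a %% N :> nat)%N%:R)) /=.
rewrite -[RHS](lifted_col_sum p_gt0 n_gt0 copq (a %% N) genA).
rewrite -(sum_single (fun u => \sum_(v < N) (lifted q A u v)%:R)).
by apply: eq_bigr => u _; rewrite mulr_suml.
Qed.

Lemma liftsum_row A b : is_generator A ->
  liftsum A (fun _ v => (v == b %% N)%N%:R) = 1.
Proof.
move=> genA; rewrite /liftsum -(pair_bigA _ (fun u v : 'I_N => (lifted q A u v)%:R *
   (v == b %% N :> nat)%N%:R)) /= exchange_big.
rewrite -[RHS](lifted_row_sum q p_gt0 n_gt0 (b %% N) genA).
rewrite -(sum_single (fun v => \sum_(u < N) (lifted q A u v)%:R)).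
by apply: eq_bigr => v _; rewrite mulr_suml.
Qed.

Lemma liftsum1 A : is_generator A -> liftsum A (fun _ _ => 1) = N%:R.
Proof.
move=> genA; rewrite /liftsum -(pair_bigA _ (fun u v : 'I_N => (lifted q A u v)%:R * 1)) /=.
transitivity (\sum_(u < N) 1 : rat); last by rewrite sumr_const card_ord.
apply: eq_bigr => u _; rewrite -[RHS](lifted_col_sum p_gt0 n_gt0 copq u genA).
by apply: eq_bigr => v _; rewrite mulr1.
Qed.

Definition wrap_term (a b w h : nat) : rat :=
  wraps a w * h%:R + wraps b h * w%:R - wraps a w * wraps b h * N%:R.

(** The signs are those of [y - x] at the vertices of one lift of a parallelogram from [x] to
    [y]. *)
Definition corner_sum (f : nat -> nat -> rat) (a b w h : nat) : rat :=
  f ((a + w) %% N)%N (b %% N)%N + f (a %% N)%N ((b + h) %% N)%N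
  - f (a %% N)%N (b %% N)%N - f ((a + w) %% N)%N ((b + h) %% N)%N.

(* The correction terms depend neither on [phi] nor on [A]: every row and
   every column of the lift of [A] contains exactly one point. *)
Lemma corner_sum_liftsum A phi sgn d a b w h : is_generator A ->
  steps phi sgn d -> sgn * sgn = 1 ->
  corner_sum (fun a b => liftsum A (fun u v => phi a u * phi b v)) a b w h =
  wrap_term a b w h - \sum_(i < w) \sum_(j < h) (lifted q A (a + i + d) (b + j + d))%:R.
Proof.
move=> genA phi_steps sgn2; rewrite /corner_sum -liftsumD -!liftsumB.
pose cols u : rat := \sum_(i < w) (u == (a + i + d) %% N)%N%:R.
pose rows v : rat := \sum_(j < h) (v == (b + j + d) %% N)%N%:R.
transitivity (liftsum A (fun u v =>
    wraps b h * cols u + wraps a w * rows v - wraps a w * wraps b h * 1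
    - \sum_(i < w) \sum_(j < h)
        (u == (a + i + d) %% N)%N%:R * (v == (b + j + d) %% N)%N%:R)).
  apply: eq_liftsum => u v uN vN.
  have := steps_sum a w phi_steps uN; have := steps_sum b h phi_steps vN.
  rewrite -/(cols u) -/(rows v) => rE cE.
  have -> : \sum_(i < w) \sum_(j < h)
      (u == (a + i + d) %% N)%N%:R * (v == (b + j + d) %% N)%N%:R = cols u * rows v.
    by rewrite /cols mulr_suml; apply: eq_bigr => i _; rewrite mulr_sumr.
  (* The corner sum of a product is minus a product of one-variable differences, so [sgn] enters
     only through its square. *)
  transitivity (- ((phi (a %% N)%N u - phi ((a + w) %% N)%N u) *
                   (phi (b %% N)%N v - phi ((b + h) %% N)%N v))); first by ring.
  rewrite cE rE mulrACA sgn2 mul1r; ring.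
have colsE : liftsum A (fun u _ => cols u) = w%:R.
  rewrite liftsum_sum (eq_bigr (fun=> 1)) => [|i _]; last exact: liftsum_col.
  by rewrite sumr_const card_ord.
have rowsE : liftsum A (fun _ v => rows v) = h%:R.
  rewrite liftsum_sum (eq_bigr (fun=> 1)) => [|j _]; last exact: liftsum_row.
  by rewrite sumr_const card_ord.
rewrite !liftsumB liftsumD !liftsumZ colsE rowsE liftsum1 // liftsum_sum.
rewrite /wrap_term; congr (_ - _); first by ring.
apply: eq_bigr => i _; rewrite liftsum_sum. apply: eq_bigr => j _.
exact: liftsum_single.
Qed.

Lemma same_col_eq A z t u v v' : is_generator A -> z \in A -> t \in A ->
  sits q z u v -> sits q t u v' -> z = t.
Proof.
move=> genA zA tA /sits_col zu /sits_col tu.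
have [s [_ _ us]] := generator_col n_gt0 u genA.
by rewrite (us z zA zu) (us t tA tu).
Qed.

Lemma same_row_eq A z t u u' v : is_generator A -> z \in A -> t \in A ->
  sits q z u v -> sits q t u' v -> z = t.
Proof.
move=> genA zA tA /sits_row zv /sits_row tv.
have [s [_ _ us]] := generator_row n_gt0 v genA.
by rewrite (us z zA zv) (us t tA tv).
Qed.

(** * Effect of a parallelogram on the Maslov and spin degrees *)

Section Rectangle.
Variable P : parallelogram p n.
Local Notation c1 := (nat_of_ord (corner P).1).
Local Notation c2 := (nat_of_ord (corner P).2).
Local Notation w := (width P).
Local Notation h := (height P).

Lemma at_posE u v z : at_pos q P u v z = sits q z (c1 + u) (c2 + v).
Proof. by rewrite /at_pos /sits !PoszD. Qed.

Lemma embedded_pos z u v u' v' : embedded q P ->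
  (u <= w)%N -> (u' <= w)%N -> (v <= h)%N -> (v' <= h)%N ->
  sits q z (c1 + u) (c2 + v) -> sits q z (c1 + u') (c2 + v') -> u = u' /\ v = v'.
Proof.
move=> /and3P[_ _ emb]; rewrite -!(ltnS _ w) -!(ltnS _ h) => uw uw' vh vh' zu zu'.
move: emb => /forallP/(_ (Ordinal uw))/forallP/(_ (Ordinal uw')).
move=> /forallP/(_ (Ordinal vh))/forallP/(_ (Ordinal vh'))/implyP /=.
have -> : lattice p q n (u%:Z - u'%:Z) (v%:Z - v'%:Z).
  by have := latticeB zu' zu; rewrite !PoszD; congr lattice; ring.
by move=> /(_ isT) /andP[/eqP[->] /eqP[->]].
Qed.

Lemma connectsP x y : connects q P x y ->
  exists x1 x2 y1 y2 : point p n, [/\ [/\ x1 \in x, x2 \in x, y1 \in y & y2 \in y],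
    [/\ sits q x1 (c1 + 0) (c2 + 0), sits q x2 (c1 + w) (c2 + h),
        sits q y1 (c1 + w) (c2 + 0) & sits q y2 (c1 + 0) (c2 + h)] &
    x :\: [set x1; x2] = y :\: [set y1; y2]].
Proof.
move=> /exists_inP[x1 x1x] /exists_inP[x2 x2x] /exists_inP[y1 y1y] /exists_inP[y2 y2y].
rewrite !at_posE => /and5P[? ? ? ? /eqP ?].
by exists x1, x2, y1, y2; split; [split|split|].
Qed.

Lemma sum_set2D (V : zmodType) (A : {set point p n}) z t (g : point p n -> V) :
  z \in A -> t \in A -> z != t ->
  \sum_(s in A) g s = g z + g t + \sum_(s in A :\: [set z; t]) g s.
Proof.
move=> zA tA zt; rewrite (big_setID [set z; t]) /=.
rewrite (setIidPr _) ?subUset ?sub1set ?zA //; congr (_ + _).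
by rewrite big_setU1 ?inE //= big_set1.
Qed.

Hypothesis embP : embedded q P.

(** Embeddedness makes the two vertices in [x] distinct, and also those in [y]; the remaining points
    are common. Rational values serve the Maslov degree, integral ones the spin degree. *)
Lemma connects_sum x y (V : zmodType) : connects q P x y ->
  exists x1 x2 y1 y2 : point p n,
    [/\ sits q x1 (c1 + 0) (c2 + 0), sits q x2 (c1 + w) (c2 + h),
        sits q y1 (c1 + w) (c2 + 0), sits q y2 (c1 + 0) (c2 + h) &
    forall g : point p n -> V, \sum_(z in y) g z - \sum_(z in x) g z =
      g y1 + g y2 - g x1 - g x2].
Proof.
case: (and3P embP) => w_gt0 h_gt0 _.
move=> /connectsP[x1 [x2 [y1 [y2 [[x1x x2x y1y y2y] [sx1 sx2 sy1 sy2] xy]]]]].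
exists x1, x2, y1, y2; split=> // g.
have x12 : x1 != x2.
  apply/eqP => x12; rewrite -x12 in sx2.
  have [w0 _] := embedded_pos embP (leq0n w) (leqnn w) (leq0n h) (leqnn h) sx1 sx2.
  by rewrite -w0 in w_gt0.
have y12 : y1 != y2.
  apply/eqP => y12; rewrite -y12 in sy2.
  have [w0 _] := embedded_pos embP (leqnn w) (leq0n w) (leq0n h) (leqnn h) sy1 sy2.
  by rewrite w0 in w_gt0.
rewrite (sum_set2D g x1x x2x x12) (sum_set2D g y1y y2y y12) xy !opprD addrACA subrr addr0.
by rewrite addrA.
Qed.

(** The lifts of the four vertices group into [p] copies of [P], translated by multiples of
    [(nq, n)]. *)
Lemma connects_liftsum x y f : connects q P x y ->
  liftsum y f - liftsum x f =
  \sum_(k < p) corner_sum f (c1 + n * q * k) (c2 + n * k) w h.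
Proof.
move=> /(@connects_sum _ _ rat)[x1 [x2 [y1 [y2 [sx1 sx2 sy1 sy2 xyE]]]]].
rewrite !liftsum_sits xyE !(sum_fiber p_gt0 n_gt0 _ sx1) !(sum_fiber p_gt0 n_gt0 _ sx2).
rewrite !(sum_fiber p_gt0 n_gt0 _ sy1) !(sum_fiber p_gt0 n_gt0 _ sy2).
rewrite -big_split -!sumrB; apply: eq_bigr => k _; rewrite /corner_sum /= !addn0.
by rewrite (addnAC _ w) (addnAC _ h).
Qed.

(** For [d = 0] the upper and right sides of [P] are left out, for [d = 1] the lower and left
    sides. *)
Definition rect_count A d : rat :=
  \sum_(i < w) \sum_(j < h) (lifted q A (c1 + i + d) (c2 + j + d))%:R.

(** By lattice invariance the [p] copies of [P] contain equally many lifted points; the wrap-around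
    sum is the same for every [A] and [phi]. *)
Lemma connects_before x y A phi sgn d : is_generator A -> connects q P x y ->
  steps phi sgn d -> sgn * sgn = 1 ->
  let f a b := liftsum A (fun u v => phi a u * phi b v) in
  liftsum y f - liftsum x f =
  \sum_(k < p) wrap_term (c1 + n * q * k) (c2 + n * k) w h - p%:R * rect_count A d.
Proof.
move=> genA xy phi_steps sgn2 f; rewrite (connects_liftsum _ xy).
rewrite (eq_bigr _ (fun (k : 'I_p) _ => corner_sum_liftsum _ _ _ _ genA phi_steps sgn2)).
rewrite sumrB; congr (_ - _).
transitivity (\sum_(k < p) rect_count A d).
  apply: eq_bigr => k _; apply: eq_bigr => i _; apply: eq_bigr => j _.
  rewrite -(lifted_shift q A (c1 + i + d) (c2 + j + d) k).
  by congr (lifted _ _ _ _)%:R; lia.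
by rewrite sumr_const card_ord mulr_natl.
Qed.

Lemma rect_count_marked M : num_marked q M P = 0%N -> rect_count M 0 = 0.
Proof.
move=> /eqP; rewrite cards_eq0 => /eqP M0.
rewrite /rect_count big1 // => i _; rewrite big1 // => j _.
rewrite !addn0; case: liftedP => // -[z zM zij].
have : z \in set0 by rewrite -M0 inE zM /=; apply/existsP; exists i;
  apply/existsP; exists j; rewrite at_posE.
by rewrite inE.
Qed.

Lemma admissible_pos x y z u v : admissible q P x y -> z \in x :|: y ->
  sits q z (c1 + u) (c2 + v) -> (0 < u < w)%N -> (0 < v < h)%N -> False.
Proof.
move=> /forall_inP adm /adm/existsP zint zuv /andP[u_gt0 uw] /andP[v_gt0 vh]; apply: zint.
by exists (Ordinal uw); apply/existsP; exists (Ordinal vh); rewrite at_posE /= u_gt0 v_gt0.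
Qed.

(** A point of [y] on the right or upper side shares a column or row with the lower right or upper
    left vertex, so it equals that vertex, which embeddedness places elsewhere. Admissibility
    excludes the interior. *)
Lemma rect_count_final x y : is_generator y -> connects q P x y ->
  admissible q P x y -> rect_count y 1 = 0.
Proof.
move=> geny /connectsP[x1 [x2 [y1 [y2 [[_ _ y1y y2y] [_ _ sy1 sy2] _]]]]] adm.
rewrite /rect_count big1 // => i _; rewrite big1 // => j _.
case: liftedP => // -[z zy]; rewrite -!addnA !addn1 => zij; exfalso.
have [iw|iw] := eqVneq i.+1 w.
  have zy1 : z = y1 by move: zij; rewrite iw => zij; exact: same_col_eq geny zy y1y zij sy1.
  rewrite zy1 in zij.
  by have [] := embedded_pos embP (leqnn w) (ltn_ord i) (leq0n h) (ltn_ord j) sy1 zij.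
have [jh|jh] := eqVneq j.+1 h.
  have zy2 : z = y2 by move: zij; rewrite jh => zij; exact: same_row_eq geny zy y2y zij sy2.
  rewrite zy2 in zij.
  by have [] := embedded_pos embP (leq0n w) (ltn_ord i) (leqnn h) (ltn_ord j) sy2 zij.
apply: (admissible_pos adm _ zij); rewrite ?inE ?zy ?orbT //.
  by rewrite andTb [(i.+1 < w)%N]ltn_neqAle iw ltn_ord.
by rewrite andTb [(j.+1 < h)%N]ltn_neqAle jh ltn_ord.
Qed.

(** The lower left vertex is counted; a point of [x] on the left or lower side equals it, and
    admissibility excludes the interior. *)
Lemma rect_count_initial x y : is_generator x -> connects q P x y ->
  admissible q P x y -> rect_count x 0 = 1.
Proof.
case: (and3P embP) => w_gt0 h_gt0 _.
move=> genx /connectsP[x1 [x2 [y1 [y2 [[x1x _ _ _] [sx1 _ _ _] _]]]]] adm.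
rewrite /rect_count pair_bigA /= (bigD1 (Ordinal w_gt0, Ordinal h_gt0)) //=.
rewrite !addn0 (_ : lifted q x c1 c2); last first.
  by apply/liftedP; exists x1 => //; rewrite -(addn0 c1) -(addn0 c2).
rewrite big1 ?addr0 // => -[i j] /= ij0; rewrite !addn0.
case: liftedP => // -[z zx zij]; exfalso; move/eqP: ij0; apply.
have [i0|i0] := posnP i.
  have zx1 : z = x1 by move: zij; rewrite i0 => zij; exact: same_col_eq genx zx x1x zij sx1.
  rewrite zx1 in zij.
  have [e1 e2] :=
    embedded_pos embP (leq0n w) (ltnW (ltn_ord i)) (leq0n h) (ltnW (ltn_ord j)) sx1 zij.
  by congr (_, _); apply: val_inj.
have [j0|j0] := posnP j.
  have zx1 : z = x1 by move: zij; rewrite j0 => zij; exact: same_row_eq genx zx x1x zij sx1.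
  rewrite zx1 in zij.
  have [e1 e2] :=
    embedded_pos embP (leq0n w) (ltnW (ltn_ord i)) (leq0n h) (ltnW (ltn_ord j)) sx1 zij.
  by congr (_, _); apply: val_inj.
exfalso; apply: (admissible_pos adm _ zij); rewrite ?inE ?zx ?i0 ?j0 //=.
Qed.

Lemma maslov_step M (x y : generator p n) : is_generator M ->
  P \in PG q (val x) (val y) -> num_marked q M P = 0%N ->
  maslov_of q M y = maslov_of q M x - 1.
Proof.
move=> genM; rewrite inE => /and3P[_ xy adm] /rect_count_marked M0.
have genx := valP x; have geny := valP y.
have changeL (r : rel nat) d A : is_generator A -> steps (fun a u => (r a u)%:R) 1 d ->
    before r (val y) A - before r (val x) A =
    \sum_(k < p) wrap_term (c1 + n * q * k) (c2 + n * k) w h - p%:R * rect_count A d.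
  by move=> genA stepr; apply: (connects_before genA xy stepr); rewrite mulr1.
have changeR A : is_generator A -> before ltn A (val y) - before ltn A (val x) =
    \sum_(k < p) wrap_term (c1 + n * q * k) (c2 + n * k) w h - p%:R * rect_count A 0.
  (* With the order of summation exchanged, the moving point is the later one, so the relevant
     indicator is that of [u < a]. *)
  move=> genA; rewrite /before !(exchange_liftsum A).
  by apply: (connects_before genA xy steps_gtn); rewrite mulrNN mulr1.
(* The change from [before ltn x x] to [before ltn y y] passes through [before ltn x y], moving one
   argument at a time. *)
have eyy := changeL ltn _ _ geny steps_ltn.
have exx := changeR _ genx.
have eM := changeL _ _ _ genM steps_leq.
have Me := changeR _ genM.
rewrite (rect_count_final geny xy adm) in eyy.
rewrite (rect_count_initial genx xy adm) in exx.
rewrite M0 in eM Me.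
have pn0 : p%:R != 0 :> rat by rewrite pnatr_eq0 -lt0n.
rewrite !maslov_ofE; set bMM := before ltn M M.
(* The two wrap-around sums from the generator term cancel those of the two mixed terms; the single
   point counted in [x] leaves [- p]. *)
have -> : before ltn (val y) (val y) - before leq (val y) M - before ltn M (val y)
    + bMM + 1 = before ltn (val x) (val x) - before leq (val x) M
    - before ltn M (val x) + bMM + 1 - p%:R by lra.
by field.
Qed.

(** Modulo [p], passing from a lift to its representative changes the index of the intersection
    point by [q] for each period [n] of height. *)
Lemma sits_quotient z u v : sits q z u v -> exists k : int,
  (z.1 %/ n)%N%:Z = (u %/ n)%N%:Z + q%:Z * ((z.2%:Z - v%:Z) %/ n%:Z)%Z + p%:Z * k.
Proof.
have nn0 : n%:Z != 0 by rewrite eqz_nat -lt0n.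
move=> /latticeP[k [l [e1 ->]]]; exists k; rewrite mulKz // -!divz_nat.
have -> : z.1%:Z = (q%:Z * l + p%:Z * k) * n%:Z + u%:Z.
  by rewrite -[LHS](subrK u%:Z) e1 PoszM; ring.
by rewrite divzMDl //; ring.
Qed.

Lemma sits_same_row z t u u' v : sits q z u v -> sits q t u' v -> z.2 = t.2.
Proof.
move=> /sits_row/dvdzP[k zE] /sits_row/dvdzP[l tE].
apply: (@small_multiple _ _ _ (k - l)).
transitivity ((z.2%:Z - v%:Z) - (t.2%:Z - v%:Z)); first by ring.
by rewrite zE tE; ring.
Qed.

(** The vertices on a common horizontal side lie in one row and have equal height corrections; those
    on a common vertical side have equal [u %/ n]. Both contributions cancel modulo [p]. *)
Lemma connects_spin (G : grid p n) (x y : generator p n) :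
  connects q P (val x) (val y) -> spin q G y = spin q G x.
Proof.
move=> /(@connects_sum _ _ int)[x1 [x2 [y1 [y2 [sx1 sx2 sy1 sy2 xyE]]]]].
have sumE : (intersection_sum (val y))%:Z - (intersection_sum (val x))%:Z =
    (y1.1 %/ n)%N%:Z + (y2.1 %/ n)%N%:Z - (x1.1 %/ n)%N%:Z - (x2.1 %/ n)%N%:Z.
  rewrite -(xyE (fun z => (z.1 %/ n)%N%:Z)) /intersection_sum.
  by rewrite -!(big_morph Posz PoszD erefl).
have [k1 e1] := sits_quotient sx1; have [k2 e2] := sits_quotient sx2.
have [k3 e3] := sits_quotient sy1; have [k4 e4] := sits_quotient sy2.
rewrite (sits_same_row sx1 sy1) in e1; rewrite (sits_same_row sx2 sy2) in e2.
rewrite /spin; apply/eqP; rewrite eqz_mod_dvd; apply/dvdzP.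
exists (k3 + k4 - k1 - k2).
transitivity ((intersection_sum (val y))%:Z - (intersection_sum (val x))%:Z); first by ring.
by rewrite sumE e1 e2 e3 e4; ring.
Qed.

End Rectangle.
End LiftSum.

(** * Degrees under the differential and existence of a homogeneous basis *)

Section Differential.
Variables (p q n : nat) (G : grid p n).
Hypotheses (p_gt0 : (0 < p)%N) (n_gt0 : (0 < n)%N) (copq : coprime p q).

Definition differential_coef (x y : generator p n) : 'F_2 :=
  #|[set P in PG q (val x) (val y) |
      (num_marked q (OO G) P == 0%N) && (num_marked q (XX G) P == 0%N)]|%:R.

Lemma differentialE c y : differential q G c y = \sum_x c x * differential_coef x y.
Proof. by rewrite lfunE /= ffunE. Qed.

Lemma differential_swap : differential q (swap_grid G) = differential q G.
Proof.
apply/lfunP => c; rewrite !lfunE; apply/ffunP => y; rewrite !ffunE.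
apply: eq_bigr => x _; congr (_ * _%:R); apply: eq_card => P.
by rewrite !inE [in LHS](andbC (num_marked _ _ _ == _)).
Qed.

Definition tridegree (x : generator p n) : int * rat * rat :=
  (spin q G x, maslov q G x, alexander q G x).

(** A nonzero coefficient provides an unmarked admissible parallelogram; it lowers the degrees with
    respect to both marking sets by 1, so their difference is unchanged. *)
Lemma differential_coef_degree x y : differential_coef x y != 0 ->
  tridegree y = ((tridegree x).1.1, (tridegree x).1.2 - 1, (tridegree x).2).
Proof.
rewrite /differential_coef; set S := [set P | _].
have [->|[P]] := set_0Vmem S; first by rewrite cards0 eqxx.
rewrite inE => /and3P[PG_P /eqP O0 /eqP X0] _.
have [embP xy _] : [/\ embedded q P, connects q P (val x) (val y)
    & admissible q P (val x) (val y)] by move: PG_P; rewrite inE => /and3P.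
have genO := marking_generator n_gt0 (OO_marking G).
have genX := marking_generator n_gt0 (XX_marking G).
rewrite /tridegree /maslov /alexander /= (connects_spin n_gt0 embP G xy).
rewrite !(maslov_step p_gt0 n_gt0 copq embP genO PG_P O0).
rewrite !(maslov_step p_gt0 n_gt0 copq embP genX PG_P X0).
by move: (maslov_of q _ x) (maslov_of q _ x) => mO mX; congr (_, _, _); ring.
Qed.

Lemma homogeneous_homology_basis_exists :
  exists (r : nat) (e : 'I_r -> chain p n), homogeneous_homology_basis q G e.
Proof.
have tau_inj : injective (fun k : int * rat * rat => (k.1.1, k.1.2 - 1, k.2)).
  by move=> [[s m] a] [[s' m'] a'] /= [-> /addIr -> ->].
have [r [e [eZ e_hom e_free e_span]]] := homogeneous_complement differentialE
  tau_inj differential_coef_degree (limg (differential q G)).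
exists r, e; split=> // i; have [ei0 [[[s m] a] eiE]] := e_hom i.
by exists s, m, a; split=> // x /eiE[-> -> ->].
Qed.

End Differential.

(** * Comparison of degrees after exchanging the two marking sets *)

Theorem proposition12 (p q n : nat) (hqp : (q < p)%N) (hpq : coprime p q)
    (G : grid p n) (hG : represents_knot G) :
  exists (k : int) (r r' : nat)
    (e : 'I_r -> chain p n) (e' : 'I_r' -> chain p n) (f : 'I_r -> 'I_r'),
    [/\ homogeneous_homology_basis q G e,
        homogeneous_homology_basis q (swap_grid G) e',
        bijective f &
        forall (i : 'I_r) (s : int) (m a : rat),
          has_degree q G (e i) s m a ->
          has_degree q (swap_grid G) (e' (f i))
            ((s + k) %% p%:Z)%Z (m - 2 * a - (n%:R - 1)) (- a - (n%:R - 1))].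
Proof.
have p_gt0 : (0 < p)%N by apply: leq_ltn_trans hqp.
have [n_gt0 _] := hG.
have [r [e eG]] := homogeneous_homology_basis_exists G p_gt0 n_gt0 hpq.
(* In [spin] only the subtracted sum over [OO] depends on the grid, so exchanging the markings
   shifts it by this difference. *)
pose k := (intersection_sum (OO G))%:Z - (intersection_sum (XX G))%:Z.
have degree_swap c s m a : has_degree q G c s m a -> has_degree q (swap_grid G) c
    ((s + k) %% p%:Z)%Z (m - 2 * a - (n%:R - 1)) (- a - (n%:R - 1)).
  move=> [c0 c_hom]; split=> // x /c_hom[<- <- <-]; split.
  - by rewrite /spin modzDml; congr modz; rewrite /k; ring.
  - rewrite /maslov /alexander /=.
    by move: (maslov_of q (OO G) x) (maslov_of q (XX G) x) => mO mX; field.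
  - rewrite /alexander /=.
    by move: (maslov_of q (OO G) x) (maslov_of q (XX G) x) => mO mX; field.
exists k, r, r, e, e, id; split.
- exact: eG.
- have [eZ e_hom e_free e_span] := eG.
  rewrite /homogeneous_homology_basis differential_swap.
  split; [exact: eZ| |exact: e_free|exact: e_span].
  move=> i; have [s [m [a ei]]] := e_hom i.
  exists ((s + k) %% p%:Z)%Z, (m - 2 * a - (n%:R - 1)), (- a - (n%:R - 1)).
  exact: degree_swap.
- by exists id.
- by move=> i s m a; apply: degree_swap.
Qed.
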